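(* Define polynomials $\gamma_n(x,y)$ by $\gamma_1(x,y)=xy$ and $$\gamma_{n+1}(x,y)=(4n+2)xy\gamma_n(x,y)+xy(1-2x)\frac{\partial}{\partial x}\gamma_n(x,y)+xy(1-4y)\frac{\partial}{\partial y}\gamma_n(x,y),$$ and write $\gamma_n(x,y)=\sum_{i,j}\gamma_{n,i,j}x^iy^j$. Then for $n\ge1$, $$C_n(x,y,z)=\sum_{i=1}^{n}x^{i}\sum_{j=0}^{\lfloor(2n+1-i)/2\rfloor}\gamma_{n,i,j}(yz)^{j}(y+z)^{2n+1-i-2j}.$$
   Context: A Stirling permutation of order $n$ is a permutation $\sigma=\sigma_1\cdots\sigma_{2n}$ of the multiset $\{1,1,2,2,\dots,n,n\}$ such that for each $i$, all entries between the two occurrences of $i$ are larger than $i$; $\mathcal Q_n$ is the set of these. Set $\sigma_0=\sigma_{2n+1}=0$. For $0\le i\le 2n$, $i$ is an ascent, descent, or plateau if $\sigma_i<\sigma_{i+1}$, $\sigma_i>\sigma_{i+1}$, or $\sigma_i=\sigma_{i+1}$ respectively; $\mathrm{asc},\mathrm{des},\mathrm{plat}$ count them. $C_n(x,y,z)=\sum_{\sigma\in\mathcal Q_n}x^{\mathrm{asc}(\sigma)}y^{\mathrm{des}(\sigma)}z^{\mathrm{plat}(\sigma)}$. *)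

(* Defs.v *)
From mathcomp Require Import all_boot all_order all_algebra.
From mathcomp.multinomials Require Import mpoly.
Set Implicit Arguments.
Unset Strict Implicit.
Unset Printing Implicit Defensive.
Import GRing.Theory.
Local Open Scope ring_scope.

(* The letter sigma_i of a word is [nth 0 s i.-1]: words are 0-indexed as
   sequences. *)
Definition stirling_multiset (n : nat) : seq nat :=
  flatten [seq [:: i; i] | i <- iota 1 n].

(* In a permutation of {1,1,...,n,n}, a pair of positions a < c carrying equal
   letters is exactly the pair of occurrences of that letter. *)
Definition is_stirling (s : seq nat) : bool :=
  [forall a : 'I_(size s), forall b : 'I_(size s), forall c : 'I_(size s),
     (a < b < c)%N ==> (nth 0%N s a == nth 0%N s c) ==>
     (nth 0%N s a < nth 0%N s b)%N].

(* [permutations] is duplicate-free, so sums over this list are sums over the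
   set Q_n. *)
Definition stirling_perms (n : nat) : seq (seq nat) :=
  [seq s <- permutations (stirling_multiset n) | is_stirling s].

(* sigma_i for 0 <= i <= size s + 1, with the convention
   sigma_0 = sigma_(size s + 1) = 0. *)
Definition letter (s : seq nat) (i : nat) : nat := nth 0%N (0%N :: rcons s 0%N) i.

Definition asc (s : seq nat) : nat :=
  count (fun i => (letter s i < letter s i.+1)%N) (iota 0 (size s).+1).

Definition des (s : seq nat) : nat :=
  count (fun i => (letter s i > letter s i.+1)%N) (iota 0 (size s).+1).

Definition plat (s : seq nat) : nat :=
  count (fun i => letter s i == letter s i.+1) (iota 0 (size s).+1).

Definition x3 : {mpoly int[3]} := 'X_(@Ordinal 3 0 isT).
Definition y3 : {mpoly int[3]} := 'X_(@Ordinal 3 1 isT).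
Definition z3 : {mpoly int[3]} := 'X_(@Ordinal 3 2 isT).

Definition C (n : nat) : {mpoly int[3]} :=
  \sum_(s <- stirling_perms n) x3 ^+ asc s * y3 ^+ des s * z3 ^+ plat s.

Definition ix : 'I_2 := @Ordinal 2 0 isT.
Definition iy : 'I_2 := @Ordinal 2 1 isT.
Definition x2 : {mpoly int[2]} := 'X_ix.
Definition y2 : {mpoly int[2]} := 'X_iy.

(* The sequence starts at n = 1; the value at 0 is a placeholder that the
   recurrence never uses. *)
Fixpoint gamma (n : nat) : {mpoly int[2]} :=
  match n with
  | 0 => 0
  | m.+1 =>
    if m == 0%N then x2 * y2 else
      (4 * m + 2)%:R * x2 * y2 * gamma m
      + x2 * y2 * (1 - 2%:R * x2) * mderiv ix (gamma m)
      + x2 * y2 * (1 - 4%:R * y2) * mderiv iy (gamma m)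
  end.

Definition gamma_coef (n i j : nat) : int :=
  (gamma n)@_[multinom [tuple i; j]].

(* Main.v *)
(* Inserting two adjacent copies of n+1 into one of the 2n+1 gaps of a Stirling
   permutation of order n replaces the step across that gap (ascent, descent or
   plateau) by an ascent, a plateau and a descent.  Hence C_(n+1) = D C_n for the
   derivation D = xyz (d/dx + d/dy + d/dz).  With u = yz and v = y + z one has
   D x = x u, D u = x u v and D v = 2 x u, so D sends x^i u^j v^k to
     i x^i u^(j+1) v^k + j x^(i+1) u^j v^(k+1) + 2k x^(i+1) u^(j+1) v^(k-1);
   for k = 2n+1-i-2j this is exactly the recurrence defining gamma_(n+1). *)

Require Import Defs.
From mathcomp Require Import all_boot all_order all_algebra.
From mathcomp.multinomials Require Import mpoly.
From mathcomp Require Import zify ring.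
Set Implicit Arguments.
Unset Strict Implicit.
Unset Printing Implicit Defensive.
Import GRing.Theory.
Local Open Scope ring_scope.

(** * The Stirling condition as a condition on subsequences *)

Lemma subseq_consP (T : eqType) (x : T) (t s : seq T) :
  reflect (exists s1 s2, s = s1 ++ x :: s2 /\ subseq t s2) (subseq (x :: t) s).
Proof.
apply: (iffP idP) => [|[s1 [s2 [-> st]]]]; last first.
  by apply: subseq_trans (suffix_subseq s1 _); rewrite /= eqxx.
elim: s => //= y s IHs; case: eqP => [<- st | _ /IHs [s1 [s2 [-> st]]]].
  by exists [::], s.
by exists (y :: s1), s2.
Qed.

(** Free of positions, the condition passes through concatenation and filtering. The case [y = x]
    also forbids three equal letters. *)
Lemma is_stirlingP (s : seq nat) :
  reflect (forall x y, subseq [:: x; y; x] s -> (x < y)%N) (is_stirling s).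
Proof.
apply: (iffP idP) => [st x y | st].
  case/subseq_consP=> s1 [s2 [def_s /subseq_consP [s3 [s4 [def_s2]]]]].
  rewrite sub1seq => /(nthP 0%N) [k lt_k def_x].
  (* These are the positions of x, y, x in [s1 ++ x :: s3 ++ y :: s4], where [k] is the place of the
     last x inside [s4]. *)
  have [lt_a lt_b lt_c] : [/\ (size s1 < size s)%N,
    (size s1 + (size s3).+1 < size s)%N &
    (size s1 + (size s3).+1 + k.+1 < size s)%N].
    rewrite def_s def_s2 !size_cat /= size_cat /=; split; try lia.
    by rewrite -addnA ltn_add2l addSn ltnS ltn_add2l.
  move/forallP/(_ (Ordinal lt_a))/forallP/(_ (Ordinal lt_b)): st.
  move/forallP/(_ (Ordinal lt_c)) => /=.
  have nthE (r r1 r2 : seq nat) z m :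
    r = r1 ++ z :: r2 -> nth 0%N r (size r1 + m) = nth 0%N (z :: r2) m.
    by move=> ->; rewrite nth_cat ltnNge leq_addr addKn.
  have nth0E r r1 r2 z : r = r1 ++ z :: r2 -> nth 0%N r (size r1) = z.
    by move=> /(nthE _ _ _ _ 0%N); rewrite addn0.
  rewrite -addnA !(nthE _ _ _ _ _ def_s) (nth0E _ _ _ _ def_s) addSn /=.
  rewrite (nthE _ _ _ _ _ def_s2) (nth0E _ _ _ _ def_s2) /= def_x eqxx /=.
  move/implyP; apply; rewrite ltn_add2l -{1}[size s1]addn0 ltn_add2l /=.
  by rewrite ltnS addnS ltnS leq_addr.
apply/forallP=> -[a lt_a]; apply/forallP=> -[b lt_b]; apply/forallP=> -[c lt_c].
apply/implyP=> /= /andP[ab bc]; apply/implyP=> /eqP ac; apply: st.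
(* Cut at the middle position: the first occurrence lies in the prefix, the second behind the head
   of the suffix. *)
rewrite -[s in subseq _ s](cat_take_drop b) (drop_nth 0%N) //.
have -> (x y : nat) : [:: x; y; x] = [:: x] ++ [:: y; x] by [].
apply: cat_subseq.
  by rewrite sub1seq -(nth_take 0%N ab) mem_nth // size_take lt_b.
rewrite /= eqxx sub1seq ac.
have -> : c = (b.+1 + (c - b.+1))%N by rewrite subnKC.
by rewrite -nth_drop mem_nth // size_drop ltn_sub2r // (leq_ltn_trans bc).
Qed.

(** * Growing Stirling permutations by a doubled maximal letter *)

Fixpoint insertions (N : nat) (s : seq nat) : seq (seq nat) :=
  [:: N, N & s] :: if s is b :: s' then map (cons b) (insertions N s') else [::].

Lemma insertionsP (N : nat) (s t : seq nat) :
  reflect (exists s1 s2, s = s1 ++ s2 /\ t = s1 ++ [:: N, N & s2])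
          (t \in insertions N s).
Proof.
apply: (iffP idP) => [|[s1 [s2 [-> ->]]]]; last first.
  elim: s1 => [|b s1 IHs1]; first by case: s2 => *; rewrite inE eqxx.
  by rewrite /= inE mem_map ?IHs1 ?orbT // => u v [].
elim: s t => [|b s IHs] t; rewrite /= inE.
  by move/eqP=> ->; exists [::], [::].
case/orP=> [/eqP ->|]; first by exists [::], (b :: s).
case/mapP=> u /IHs [s1 [s2 [-> ->]]] ->.
by exists (b :: s1), s2.
Qed.

Lemma filter_predC1_notin (T : eqType) (x : T) (s : seq T) :
  x \notin s -> filter (predC1 x) s = s.
Proof.
by move=> xs; apply/all_filterP/allP=> y ys; apply: contraNneq xs => <-.
Qed.

Lemma insertionsK (N : nat) (s t : seq nat) :
  N \notin s -> t \in insertions N s -> filter (predC1 N) t = s.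
Proof.
move=> Ns /insertionsP [s1 [s2 [def_s ->]]].
by rewrite filter_cat /= eqxx /= -filter_cat -def_s filter_predC1_notin.
Qed.

Lemma insertions_uniq (N : nat) (s : seq nat) : N \notin s -> uniq (insertions N s).
Proof.
elim: s => //= b s IHs; rewrite inE negb_or => /andP[Nb Ns].
rewrite map_inj_uniq ?IHs ?andbT // => [|u v []//].
by apply/mapP=> -[u _ [/eqP]]; rewrite (negPf Nb).
Qed.

(** In a pattern x y x of the longer word, x = N is impossible, as the two N are adjacent and there
    is no third; y = N is harmless, as N exceeds every other letter; any other pattern survives the
    deletion of N. *)
Lemma insertions_stirling (N : nat) (s1 s2 : seq nat) :
    all (ltn^~ N) (s1 ++ s2) ->
  is_stirling (s1 ++ [:: N, N & s2]) = is_stirling (s1 ++ s2).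
Proof.
move=> ltN; have Ns12 : N \notin s1 ++ s2.
  by apply/negP=> /(allP ltN); rewrite /= ltnn.
apply/is_stirlingP/is_stirlingP => st x y sub.
  apply: st; apply: subseq_trans sub _; apply: cat_subseq => //.
  exact: (suffix_subseq [:: N; N]).
have [def_x | neq_x] := eqVneq x N.
  case/negP: Ns12; move: sub; rewrite {}def_x mem_cat.
  (* If N y N were a subsequence, one of its letters N would have to fall in [s1] or [s2]. *)
  elim: s1 {ltN st} => [|b s1 IHs1] /=; last first.
    by rewrite inE; case: eqVneq => //= _ /IHs1.
  rewrite eqxx; case: eqVneq => [_|_]; first by rewrite sub1seq.
  by move/(mem_subseq) => /(_ N); rewrite !inE eqxx orbT; apply.
have [-> | neq_y] := eqVneq y N.
  have: x \in s1 ++ [:: N, N & s2] by apply: (mem_subseq sub); rewrite !inE eqxx.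
  rewrite mem_cat !inE (negPf neq_x) /= -mem_cat; exact: (allP ltN).
apply: st; rewrite -(@filter_predC1_notin _ N (s1 ++ s2)) //.
have -> : filter (predC1 N) (s1 ++ s2) = filter (predC1 N) (s1 ++ [:: N, N & s2]).
  by rewrite !filter_cat /= eqxx.
by rewrite subseq_filter sub /= neq_x neq_y.
Qed.

Lemma mem_stirling_multiset (n k : nat) :
  (k \in stirling_multiset n) = (0 < k <= n)%N.
Proof.
apply/flatten_mapP/idP => [[i]|kn].
  by rewrite mem_iota !inE orbb => iN /eqP ->; lia.
by exists k; rewrite ?inE ?eqxx // mem_iota; lia.
Qed.

Lemma stirling_multisetS (n : nat) :
  stirling_multiset n.+1 = stirling_multiset n ++ [:: n.+1; n.+1].
Proof. by rewrite /stirling_multiset -{1}(addn1 n) iotaD map_cat flatten_cat add1n. Qed.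

Lemma mem_stirling_perms (n : nat) (s : seq nat) :
  (s \in stirling_perms n) = is_stirling s && perm_eq s (stirling_multiset n).
Proof. by rewrite mem_filter mem_permutations. Qed.

Lemma stirling_perms_bound (n : nat) (s : seq nat) :
  s \in stirling_perms n -> all (fun k => 0 < k <= n)%N s.
Proof.
rewrite mem_stirling_perms => /andP[_ /perm_mem eq_s].
by apply/allP=> k; rewrite eq_s mem_stirling_multiset.
Qed.

Lemma mem_stirling_permsS (n : nat) (t : seq nat) :
  (t \in stirling_perms n.+1) =
    (t \in flatten [seq insertions n.+1 s | s <- stirling_perms n]).
Proof.
have perm_ins s1 s2 : perm_eq (s1 ++ [:: n.+1, n.+1 & s2]) (stirling_multiset n.+1)
    = perm_eq (s1 ++ s2) (stirling_multiset n).
  rewrite stirling_multisetS -(perm_cat2r [:: n.+1; n.+1] (s1 ++ s2)).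
  apply: permPl; rewrite -catA perm_cat2l.
  by rewrite -[[:: n.+1, n.+1 & s2]]/([:: n.+1; n.+1] ++ s2) perm_catC.
have lt_n s : s \in stirling_perms n -> all (ltn^~ n.+1) s.
  by move/stirling_perms_bound; apply: sub_all => k /andP[].
apply/idP/flatten_mapP => [tQ | [s sQ /insertionsP [s1 [s2 [def_s ->]]]]]; last first.
  rewrite mem_stirling_perms perm_ins insertions_stirling -?def_s ?lt_n //.
  by rewrite -mem_stirling_perms.
have := tQ; rewrite mem_stirling_perms => /andP[/is_stirlingP st perm_t].
have cnt: count_mem n.+1 t = 2%N.
  rewrite (permP perm_t) stirling_multisetS count_cat /= eqxx.
  by rewrite (count_memPn _) // mem_stirling_multiset; lia.
have: subseq (nseq 2 n.+1) t.
  rewrite -cnt -size_filter -(all_pred1P _ _ (filter_all _ t)).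
  exact: filter_subseq.
(* Nothing can stand between the two occurrences of the maximal letter n+1. *)
case/subseq_consP=> a [u [def_t /subseq_consP [b [c [def_u _]]]]].
rewrite {u}def_u in def_t; case: b => [|y b] /= in def_t.
  exists (a ++ c); last by apply/insertionsP; exists a, c.
  rewrite mem_stirling_perms -perm_ins -def_t perm_t andbT.
  (* A further n+1 in [a ++ c] would exceed its multiplicity two in [t]. *)
  have ltN : all (ltn^~ n.+1) (a ++ c).
    apply/allP=> k kac; have k_t : k \in t.
      by move: kac; rewrite def_t !mem_cat !inE => /orP[] ->; rewrite ?orbT.
    have := k_t; rewrite (perm_mem perm_t) mem_stirling_multiset /=.
    case/andP=> _; rewrite leq_eqVlt => /predU1P[def_k|//]; exfalso.
    move: cnt; rewrite def_t count_cat /= eqxx !add1n !addnS => -[] /eqP.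
    by rewrite -count_cat -leqn0 leqNgt -has_count has_pred1 -def_k kac.
  by rewrite -(insertions_stirling ltN) -def_t; apply/is_stirlingP.
have: (n.+1 < y)%N.
  apply: st; rewrite def_t; apply: subseq_trans (suffix_subseq _ _).
  by rewrite /= !eqxx /= sub1seq mem_cat inE eqxx orbT.
have: y \in t by rewrite def_t mem_cat !inE eqxx !orbT.
by rewrite (perm_mem perm_t) mem_stirling_multiset; lia.
Qed.

Lemma flatten_map_uniq (T S : eqType) (f : T -> seq S) (s : seq T) :
    uniq s -> {in s, forall x, uniq (f x)} ->
    {in s &, forall x y t, t \in f x -> t \in f y -> x = y} ->
  uniq (flatten [seq f x | x <- s]).
Proof.
elim: s => //= x s IHs /andP[xs s_uniq] f_uniq f_inj.
rewrite cat_uniq f_uniq ?mem_head // IHs //=; last 2 first.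
- by move=> y ys; apply: f_uniq; rewrite inE ys orbT.
- by move=> y z ys zs; apply: f_inj; rewrite inE ?ys ?zs orbT.
rewrite andbT; apply/hasPn=> t /flatten_mapP [y ys ty]; apply: contra xs => tx.
by rewrite (f_inj x y _ _ t) ?inE ?eqxx ?ys ?orbT.
Qed.

Lemma notin_stirling_perms (n : nat) (s : seq nat) :
  s \in stirling_perms n -> n.+1 \notin s.
Proof.
by move/stirling_perms_bound/allP=> s_n; apply/negP=> /s_n; rewrite ltnn.
Qed.

(** Each word arises exactly once: the gaps of one [s] give different words, and deleting n+1
    recovers [s], so the lists of different [s] are disjoint. *)
Lemma perm_stirling_permsS (n : nat) :
  perm_eq (stirling_perms n.+1)
    (flatten [seq insertions n.+1 s | s <- stirling_perms n]).
Proof.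
have Q_uniq m : uniq (stirling_perms m) by rewrite filter_uniq ?permutations_uniq.
apply: uniq_perm (mem_stirling_permsS n) => //.
apply: flatten_map_uniq => // [s /notin_stirling_perms /insertions_uniq //|].
move=> s1 s2 /notin_stirling_perms Ns1 /notin_stirling_perms Ns2 t t1 t2.
by rewrite -(insertionsK Ns1 t1) -(insertionsK Ns2 t2).
Qed.

(** * Step weights and the derivation D *)

Definition step (a b : nat) : {mpoly int[3]} :=
  if (a < b)%N then x3 else if (b < a)%N then y3 else z3.

(** The preceding letter is a parameter so that weights obey the same recursion as [insertions]; the
    boundary zeros are supplied by taking [a = 0] and appending 0. *)
Fixpoint path_weight (a : nat) (s : seq nat) : {mpoly int[3]} :=
  if s is b :: s' then step a b * path_weight b s' else 1.

Lemma path_weightE (a : nat) (s : seq nat) (l := nth 0%N (a :: s)) :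
  path_weight a s =
    x3 ^+ count (fun i => l i < l i.+1)%N (iota 0 (size s)) *
    y3 ^+ count (fun i => l i > l i.+1)%N (iota 0 (size s)) *
    z3 ^+ count (fun i => l i == l i.+1) (iota 0 (size s)).
Proof.
rewrite {}/l; elim: s a => [|b s IHs] a; first by rewrite /= !expr0 !mulr1.
have countS (r : rel nat) :
    count (fun i => r (nth 0%N [:: a, b & s] i) (nth 0%N [:: a, b & s] i.+1))
      (iota 0 (size (b :: s))) =
    (r a b + count (fun i => r (nth 0%N (b :: s) i) (nth 0%N (b :: s) i.+1))
      (iota 0 (size s)))%N.
  by rewrite /= (iotaDl 1 0) count_map.
rewrite (countS ltn) (countS (fun i j => j < i)%N) (countS eq_op) !exprD.
rewrite [path_weight _ _]/= IHs /step /=.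
by case: ltngtP => _; rewrite /= ?expr0 ?expr1; ring.
Qed.

Lemma mderiv_var (n : nat) (R : nzRingType) (a b : 'I_n) :
  mderiv a ('X_b : {mpoly R[n]}) = (a == b)%:R.
Proof.
rewrite mderivX mnm1E eq_sym; case: eqVneq => [->|_]; last by rewrite scale0r.
have -> : (U_(b) - U_(b))%MM = 0%MM by apply/mnmP=> l; rewrite mnmBE subnn mnm0E.
by rewrite scale1r mpolyX0.
Qed.

Definition stirling_derivation (p : {mpoly int[3]}) : {mpoly int[3]} :=
  x3 * y3 * z3 * \sum_(i < 3) mderiv i p.

Local Notation D := stirling_derivation.

Lemma derivationD p q : D (p + q) = D p + D q.
Proof.
rewrite /D -mulrDr -big_split; congr (_ * _).
by apply: eq_bigr => i _; rewrite mderivD.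
Qed.

Lemma derivation0 : D 0 = 0.
Proof. by rewrite /D big1 ?mulr0 // => i _; rewrite mderiv0. Qed.

Lemma derivation1 : D 1 = 0.
Proof. by rewrite /D big1 ?mulr0 // => i _; rewrite mderivC. Qed.

Lemma derivationZ c p : D (c *: p) = c *: D p.
Proof.
rewrite /D scalerAr scaler_sumr; congr (_ * _).
by apply: eq_bigr => i _; rewrite mderivZ.
Qed.

Lemma derivationM p q : D (p * q) = D p * q + p * D q.
Proof.
rewrite /D (eq_bigr _ (fun i _ => mderivM i p q)) big_split /=.
by rewrite -mulr_suml -mulr_sumr; ring.
Qed.

Lemma derivationX p k : D (p ^+ k) = k%:R * p ^+ k.-1 * D p.
Proof.
elim: k => [|k IHk]; first by rewrite expr0 derivation1 !mul0r.
rewrite exprS derivationM IHk /=; case: k {IHk} => [|k] /=; first by ring.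
by rewrite exprS -(natr1 k.+1); ring.
Qed.

Lemma derivation_sum (I : Type) (r : seq I) (F : I -> {mpoly int[3]}) :
  D (\sum_(i <- r) F i) = \sum_(i <- r) D (F i).
Proof. exact: (big_morph _ derivationD derivation0). Qed.

Lemma derivation_var (i : 'I_3) : D 'X_i = x3 * y3 * z3.
Proof.
rewrite /D (bigD1 i) //= big1 => [|j /negPf ji]; last by rewrite mderiv_var ji.
by rewrite mderiv_var eqxx addr0 mulr1.
Qed.

Lemma derivation_step a b : D (step a b) = x3 * y3 * z3.
Proof. by rewrite /step; case: ifP => _; [|case: ifP => _]; apply: derivation_var. Qed.

Lemma stirling_weightE (s : seq nat) :
  x3 ^+ asc s * y3 ^+ des s * z3 ^+ plat s = path_weight 0 (rcons s 0%N).
Proof. by rewrite path_weightE size_rcons. Qed.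

(** This is the Leibniz rule along the path. Inserting in the first gap replaces its step by a < N =
    N > b, of weight xzy, which is D of any single step; the other insertions keep that step and
    fall under induction. Positivity of N makes the step to the final 0 a descent. *)
Lemma sum_insertions (N a : nat) (s : seq nat) :
    (0 < N)%N -> all (ltn^~ N) (a :: s) ->
  \sum_(t <- insertions N s) path_weight a (rcons t 0%N) =
    D (path_weight a (rcons s 0%N)).
Proof.
move=> N_gt0; elim: s a => [|b s IHs] a.
  case/andP=> /= aN _; rewrite big_seq1 /= !mulr1 derivation_step /step.
  rewrite aN ltnn N_gt0 ltn0. move: x3 y3 z3 => x y z; ring.
case/andP=> /= aN bsN; have /andP[/= bN _] := bsN.
rewrite /= big_cons big_map /= -mulr_sumr IHs // derivationM derivation_step.
by rewrite /step aN ltnn ltnNge ltnW // bN /=; move: x3 y3 z3 => x y z; ring.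
Qed.

Lemma C_succ (n : nat) : C n.+1 = D (C n).
Proof.
have CE m : C m = \sum_(s <- stirling_perms m) path_weight 0 (rcons s 0%N).
  by apply: eq_bigr => s _; apply: stirling_weightE.
rewrite !CE (perm_big _ (perm_stirling_permsS n)) big_flatten big_map.
rewrite derivation_sum; apply: eq_big_seq => s sQ; apply: sum_insertions => //=.
by apply: sub_all (stirling_perms_bound sQ) => k /andP[].
Qed.

(** * Matching the recurrence for gamma with D, monomial by monomial *)

Definition gamma_step (n : nat) (p : {mpoly int[2]}) : {mpoly int[2]} :=
  (4 * n + 2)%:R * x2 * y2 * p
  + x2 * y2 * (1 - 2%:R * x2) * mderiv ix p
  + x2 * y2 * (1 - 4%:R * y2) * mderiv iy p.

Lemma gamma_succ (n : nat) : (0 < n)%N -> gamma n.+1 = gamma_step n (gamma n).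
Proof. by case: n. Qed.

(* The monomials x^i y^j of gamma_n are tracked together with their images, so
   that the truncated exponent 2n+1-i-2j is always a genuine difference. *)
Inductive gamma_lift (n : nat) : {mpoly int[2]} -> {mpoly int[3]} -> Prop :=
| GammaLift0 : gamma_lift n 0 0
| GammaLiftD p1 p2 q1 q2 of gamma_lift n p1 q1 & gamma_lift n p2 q2 :
    gamma_lift n (p1 + p2) (q1 + q2)
| GammaLiftX (c : int) i j of (1 <= i <= n)%N & (i + 2 * j <= 2 * n + 1)%N :
    gamma_lift n (c *: (x2 ^+ i * y2 ^+ j))
      (c *: (x3 ^+ i * ((y3 * z3) ^+ j * (y3 + z3) ^+ (2 * n + 1 - i - 2 * j)))).

(** At [k = 0] the truncated exponent does no harm, since the factor k vanishes. *)
Lemma natr_mulX_pred (R : comNzRingType) (p : R) k :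
  k%:R * p ^+ k.-1 * p = k%:R * p ^+ k.
Proof. by case: k => [|k]; rewrite ?mul0r // -mulrA -exprSr. Qed.

Lemma derivation_lift_monomial (i j k : nat) :
  D (x3 ^+ i * ((y3 * z3) ^+ j * (y3 + z3) ^+ k)) =
    i%:R *: (x3 ^+ i * ((y3 * z3) ^+ j.+1 * (y3 + z3) ^+ k))
    + j%:R *: (x3 ^+ i.+1 * ((y3 * z3) ^+ j * (y3 + z3) ^+ k.+1))
    + (2 * k)%:R *: (x3 ^+ i.+1 * ((y3 * z3) ^+ j.+1 * (y3 + z3) ^+ k.-1)).
Proof.
have Du : D (y3 * z3) = (y3 * z3) * (x3 * (y3 + z3)).
  by rewrite derivationM !derivation_var; ring.
have Dv : D (y3 + z3) = 2%:R * x3 * (y3 * z3).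
  by rewrite derivationD !derivation_var; ring.
have Dx : D x3 = x3 * (y3 * z3) by rewrite derivation_var mulrA.
have Dxi : D (x3 ^+ i) = i%:R * x3 ^+ i * (y3 * z3).
  by rewrite derivationX Dx mulrA natr_mulX_pred.
have Duj : D ((y3 * z3) ^+ j) = j%:R * (y3 * z3) ^+ j * (x3 * (y3 + z3)).
  by rewrite derivationX Du mulrA natr_mulX_pred.
rewrite derivationM Dxi derivationM Duj derivationX Dv.
rewrite !scaler_nat -!(mulr_natl (_ * _)) natrM.
move: (y3 * z3) (y3 + z3) => u v; rewrite !exprS; ring.
Qed.

(** The Euler operators x d/dx and y d/dy act on the monomial as the scalars i and j. Multiplied by
    y and x they give the first two terms; the contributions -2i and -4j combine with 4n+2 into
    2k. *)
Lemma gamma_step_monomial (n i j : nat) (k := (2 * n + 1 - i - 2 * j)%N) :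
    (i + 2 * j <= 2 * n + 1)%N ->
  gamma_step n (x2 ^+ i * y2 ^+ j) =
    i%:R *: (x2 ^+ i * y2 ^+ j.+1)
    + j%:R *: (x2 ^+ i.+1 * y2 ^+ j)
    + (2 * k)%:R *: (x2 ^+ i.+1 * y2 ^+ j.+1).
Proof.
move=> le_ij.
have dX a b m : mderiv a (('X_b : {mpoly int[2]}) ^+ m) =
    m%:R * 'X_b ^+ m.-1 * (a == b)%:R.
  elim: m => [|m IHm]; first by rewrite expr0 mderivC !mul0r.
  rewrite exprS mderivM IHm mderiv_var /=; case: m {IHm} => [|m] /=; first by ring.
  by rewrite exprS -(natr1 m.+1); ring.
have dx : x2 * mderiv ix (x2 ^+ i * y2 ^+ j) = i%:R * (x2 ^+ i * y2 ^+ j).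
  rewrite mderivM !dX /= mulr0 mulr0 addr0 mulr1 [RHS]mulrA.
  by rewrite -natr_mulX_pred -/x2 -/y2; move: x2 y2 => x y; ring.
have dy : y2 * mderiv iy (x2 ^+ i * y2 ^+ j) = j%:R * (x2 ^+ i * y2 ^+ j).
  rewrite mderivM !dX /= mulr0 mul0r add0r mulr1 [RHS]mulrCA.
  by rewrite -natr_mulX_pred -/x2 -/y2; move: x2 y2 => x y; ring.
(* Here [le_ij] is needed: it makes [k] a true difference. *)
have k2 : (2 * k)%:R = (4 * n + 2)%:R - 2%:R * i%:R - 4%:R * j%:R :> {mpoly int[2]}.
  have -> : (4 * n + 2 = 2 * k + 2 * i + 4 * j)%N by rewrite /k; lia.
  by move: (k) => l; ring.
rewrite /gamma_step !scaler_nat -!(mulr_natl (_ * _)) k2 {k2 dX}.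
move: (mderiv ix _) (mderiv iy _) dx dy; move: x2 y2 => x y A B dx dy.
(* Each derivative is paired with its own variable, so that exponents lowered by one never
   appear. *)
have -> : x * y * (1 - 2%:R * x) * A = (x * A) * (y * (1 - 2%:R * x)) by ring.
have -> : x * y * (1 - 4%:R * y) * B = (y * B) * (x * (1 - 4%:R * y)) by ring.
by rewrite dx dy !exprS; ring.
Qed.

(** A monomial may leave the admissible range as long as its coefficient is zero. *)
Lemma gamma_liftX (n : nat) (c : int) (i j : nat) :
    (c != 0 -> (1 <= i <= n)%N /\ (i + 2 * j <= 2 * n + 1)%N) ->
  gamma_lift n (c *: (x2 ^+ i * y2 ^+ j))
    (c *: (x3 ^+ i * ((y3 * z3) ^+ j * (y3 + z3) ^+ (2 * n + 1 - i - 2 * j)))).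
Proof.
have [-> _ | _ []// *] := eqVneq c 0; first by rewrite !scale0r; constructor.
by constructor.
Qed.

Lemma gamma_stepD n p q : gamma_step n (p + q) = gamma_step n p + gamma_step n q.
Proof.
rewrite /gamma_step !mderivD; move: (mderiv ix p) (mderiv iy p).
by move: (mderiv ix q) (mderiv iy q) x2 y2 => a b x y a' b'; ring.
Qed.

Lemma gamma_step0 n : gamma_step n 0 = 0.
Proof. by rewrite /gamma_step !mderiv0 !mulr0 !addr0. Qed.

Lemma gamma_stepZ n c p : gamma_step n (c *: p) = c *: gamma_step n p.
Proof. by rewrite /gamma_step !mderivZ -!scalerAr -!scalerDr. Qed.

Lemma gamma_lift_step (n : nat) p q :
  gamma_lift n p q -> gamma_lift n.+1 (gamma_step n p) (D q).
Proof.
elim=> {p q} [|p1 p2 q1 q2 _ IH1 _ IH2|c i j i_n ij_n].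
- by rewrite gamma_step0 derivation0; constructor.
- by rewrite gamma_stepD derivationD; constructor.
rewrite gamma_stepZ derivationZ gamma_step_monomial // derivation_lift_monomial.
set k := (2 * n + 1 - i - 2 * j)%N.
have k1 : k = (2 * n.+1 + 1 - i - 2 * j.+1)%N by rewrite /k; lia.
have k2 : k.+1 = (2 * n.+1 + 1 - i.+1 - 2 * j)%N by rewrite /k; lia.
have k3 : k.-1 = (2 * n.+1 + 1 - i.+1 - 2 * j.+1)%N by rewrite /k; lia.
rewrite [in _ ^+ k]k1 k2 k3 !scalerDr !scalerA.
(* Only the third monomial can break the bound, namely when [k = 0], and then its coefficient 2k
   vanishes. *)
by apply: GammaLiftD; first apply: GammaLiftD; apply: gamma_liftX; split; lia.
Qed.

Lemma gamma_lift_C (n : nat) : (0 < n)%N -> gamma_lift n (gamma n) (C n).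
Proof.
elim: n => // -[_ _|n IHn _]; last first.
  by rewrite gamma_succ // C_succ; apply: gamma_lift_step; apply: IHn.
have -> : C 1 = 1 *: (x3 ^+ 1 * ((y3 * z3) ^+ 1 * (y3 + z3) ^+ (2 * 1 + 1 - 1 - 2 * 1))).
  (* The only word of order 1 is 11, inserted into the empty word; its weight xyz is the image of
     the monomial xy, with v-exponent 0. *)
  have perm1 : perm_eq (stirling_perms 1) [:: [:: 1; 1]]%N.
    rewrite (permPl (perm_stirling_permsS 0)).
    have st0 : is_stirling [::] by apply/is_stirlingP.
    have -> : stirling_perms 0 = [:: [::]] by rewrite /stirling_perms /= st0.
    by [].
  rewrite /C (perm_big _ perm1) big_seq1 stirling_weightE /= /step /=.
  by rewrite scale1r expr0 !mulr1 !expr1; move: x3 y3 z3 => x y z; ring.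
have -> : gamma 1 = 1 *: (x2 ^+ 1 * y2 ^+ 1) by rewrite scale1r.
by constructor.
Qed.

(** * Reading off the coefficients *)

(** The right-hand side is additive in [p], so a single monomial suffices. Its double sum has one
    surviving term, and the bounds carried by [gamma_lift] place that term inside the summation
    range. *)
Lemma gamma_liftE (n : nat) p q : gamma_lift n p q ->
  q = \sum_(1 <= i < n.+1) x3 ^+ i *
        \sum_(0 <= j < ((2 * n + 1 - i) %/ 2).+1)
          p@_[multinom [tuple i; j]] *:
            ((y3 * z3) ^+ j * (y3 + z3) ^+ (2 * n + 1 - i - 2 * j)).
Proof.
elim=> {p q} [|p1 p2 q1 q2 _ {1}-> _ {1}->|c i j i_n ij_n].
- by rewrite big1 // => i _; rewrite big1 ?mulr0 // => j _; rewrite mcoeff0 scale0r.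
- rewrite -big_split; apply: eq_bigr => i _; rewrite /= -mulrDr -big_split.
  by congr (_ * _); apply: eq_bigr => j _; rewrite mcoeffD scalerDl.
have coefE a b : (c *: (x2 ^+ i * y2 ^+ j))@_[multinom [tuple a; b]] =
    c * ((a == i) && (b == j))%:R.
  rewrite mcoeffZ !mpolyXn -mpolyXD mcoeffX; congr (_ * (_ : bool)%:R).
  apply/eqP/andP => [/mnmP eq_m | [/eqP -> /eqP ->]].
    have := (eq_m ix, eq_m iy).
    rewrite !mnmDE !mulmnE !mnm1E !multinomE !(tnth_nth 0%N) /=.
    by case; rewrite !mul1n !mul0n addn0 add0n => -> ->; rewrite !eqxx.
  apply/mnmP=> l; rewrite !mnmDE !mulmnE !mnm1E multinomE (tnth_nth 0%N).
  by case: l => -[|[|]]//= _; rewrite ?mul1n ?mul0n ?addn0 ?add0n.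
rewrite (bigD1_seq i) ?iota_uniq ?mem_index_iota //=.
rewrite [X in _ = _ + X]big1 ?addr0 => [|a /negPf ai]; last first.
  by rewrite big1 ?mulr0 // => b _; rewrite coefE ai mulr0 scale0r.
(* That j is in range is [ij_n]: i + 2j <= 2n+1 gives j <= (2n+1-i)/2. *)
rewrite (bigD1_seq j) ?iota_uniq ?mem_index_iota //=; last by lia.
rewrite big1 ?addr0 => [|b /negPf bj]; last first.
  by rewrite coefE bj andbF mulr0 scale0r.
by rewrite coefE !eqxx mulr1 scalerAr.
Qed.

Theorem theorem8 (n : nat) (hn : (1 <= n)%N) :
  C n = \sum_(1 <= i < n.+1) x3 ^+ i *
          \sum_(0 <= j < ((2 * n + 1 - i) %/ 2).+1)
             gamma_coef n i j *: ((y3 * z3) ^+ j * (y3 + z3) ^+ (2 * n + 1 - i - 2 * j)).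
Proof. exact: gamma_liftE (gamma_lift_C hn). Qed.
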